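(* Let $\gamma:I\to S_1^4$ be a spacelike nongeodesic biharmonic curve parametrized by arclength, and let $\{T,N,B_1,B_2\}$ be a Frenet frame along $\gamma$ such that the principal normal vector $N$ and the first binormal vector $B_1$ are spacelike, with first curvature $k_1$. Then we have two cases: (i) $\gamma$ is a circle of radius $\frac{1}{\sqrt2}$; (ii) $\gamma(s)=\left(0,\frac{\cos(as)}{\sqrt2},\frac{\sin(as)}{\sqrt2},\frac{\cos(bs)}{\sqrt2},\frac{\sin(bs)}{\sqrt2}\right)$, where $a=\sqrt{1-k_1}$ and $b=\sqrt{1+k_1}$.
   Context: $\mathbb R_1^5$ is $\mathbb R^5$ with the Lorentzian inner product $\langle x,y\rangle=-x_1y_1+x_2y_2+x_3y_3+x_4y_4+x_5y_5$, and $S_1^4=\{x\in\mathbb R_1^5:\langle x,x\rangle=1\}$ is the Lorentzian unit sphere with the induced Lorentzian metric and its Levi-Civita connection $\nabla$; $R(X,Y)=[\nabla_X,\nabla_Y]-\nabla_{[X,Y]}$. $I\subset\mathbb R$ is an interval and $T=\gamma'$; $\gamma$ is spacelike parametrized by arclength if $\langle T,T\rangle=1$. $\gamma$ is biharmonic if $\nabla_T^3T-R(T,\nabla_TT)T=0$; nongeodesic means not a geodesic. Frenet frame in this case ($T$ tangent, $N$ principal normal, $B_1$ first binormal, $B_2$ second binormal): $T,N,B_1,B_2$ are mutually orthogonal, tangent to $S_1^4$, with $\langle T,T\rangle=\langle N,N\rangle=\langle B_1,B_1\rangle=1$, $\langle B_2,B_2\rangle=-1$, and $\nabla_TT=k_1N$,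 $\nabla_TN=-k_1T+k_2B_1$, $\nabla_TB_1=-k_2N+k_3B_2$, $\nabla_TB_2=k_3B_1$, where the functions $k_1,k_2,k_3$ are the first, second and third curvatures of $\gamma$. A circle of radius $\frac{1}{\sqrt2}$ is a curve of the form $\gamma(s)=c+u\cos(\sqrt2 s)+v\sin(\sqrt2 s)$ with $c,u,v\in\mathbb R_1^5$ constant, $u,v$ orthogonal and $\langle u,u\rangle=\langle v,v\rangle=\frac12$.
   Formalization: In case (ii) the formula for γ is asserted only up to a linear Lorentz isometry of R_1^5, with k_1 proved constant; the literal equality is false, since reflecting such a curve in a coordinate preserves every hypothesis but changes its coordinates. *)

(* Defs.v *)
From HB Require Import structures.
From mathcomp Require Import all_boot all_order all_algebra.
From mathcomp Require Import all_classical all_reals all_analysis.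
From mathcomp Require Import ring.
Set Implicit Arguments.
Unset Strict Implicit.
Unset Printing Implicit Defensive.
Import Order.TTheory GRing.Theory Num.Theory.
Import numFieldNormedType.Exports.
Local Open Scope classical_set_scope.
Local Open Scope ring_scope.

Section DeSitterSpace.
Variable R : realType.
Notation E := 'rV[R]_5.
Implicit Types (x y z p : E) (X Y Z : E -> E).

Definition lor x y : R :=
  - (x 0 0 * y 0 0) + \sum_(i < 4) x 0 (lift ord0 i) * y 0 (lift ord0 i).

Definition lorentz_isometry (L : 'M[R]_5) : Prop :=
  forall x y, lor (x *m L) (y *m L) = lor x y.

Definition deSitter : set E := [set p | lor p p = 1].

Definition tangent p x : Prop := lor x p = 0.

(* Projection onto the tangent space at p, for p in deSitter: the position
   vector p is then the unit normal at p. *)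
Definition tproj p x : E := x - lor x p *: p.

(* Vector fields of the sphere are represented by maps E -> E that are tangent
   at each of its points. The Levi-Civita connection of a nondegenerate
   hypersurface of a flat space is the tangential part of the ambient
   directional derivative (Gauss formula); nabla_metric and nabla_torsion_free
   below check its two characteristic properties. *)
Definition nabla X Y : E -> E := fun p => tproj p ('D_(X p) Y p).

Definition lie X Y : E -> E := fun p => 'D_(X p) Y p - 'D_(Y p) X p.

Definition curvature X Y Z : E -> E := fun p =>
  nabla X (nabla Y Z) p - nabla Y (nabla X Z) p - nabla (lie X Y) Z p.

(* R(x, y)z for x, y, z tangent at p. By tensoriality any tangent fields with
   these values at p give the same result; fun q => tproj q x is such a field
   for x, since tproj p x = x. *)
Definition curvature_at p x y z : E :=
  curvature (tproj^~ x) (tproj^~ y) (tproj^~ z) p.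

Lemma lorC x y : lor x y = lor y x.
Proof.
by rewrite /lor mulrC; congr (_ + _); apply: eq_bigr => i _; rewrite mulrC.
Qed.

Lemma lorDl x y z : lor (x + y) z = lor x z + lor y z.
Proof. rewrite /lor !big_ord_recr !big_ord0 /= !mxE; ring. Qed.

Lemma lorZl a x z : lor (a *: x) z = a * lor x z.
Proof. rewrite /lor !big_ord_recr !big_ord0 /= !mxE; ring. Qed.

Lemma lorBl x y z : lor (x - y) z = lor x z - lor y z.
Proof. by rewrite -scaleN1r lorDl lorZl mulN1r. Qed.

Lemma lorBr x y z : lor x (y - z) = lor x y - lor x z.
Proof. by rewrite lorC lorBl !(lorC x). Qed.

Lemma lorZr a x z : lor x (a *: z) = a * lor x z.
Proof. by rewrite lorC lorZl lorC. Qed.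

Lemma tprojB p x y : tproj p (x - y) = tproj p x - tproj p y.
Proof.
by rewrite /tproj lorBl scalerBl !opprD !opprK addrACA.
Qed.

Lemma lor_tproj p x y : tangent p y -> lor (tproj p x) y = lor x y.
Proof.
by rewrite /tangent /tproj => py; rewrite lorBl lorZl (lorC p) py mulr0 subr0.
Qed.

Lemma tangent_tproj p x : deSitter p -> tangent p (tproj p x).
Proof.
by rewrite /tangent /tproj => pS; rewrite lorBl lorZl pS mulr1 subrr.
Qed.

Lemma tproj_tangent p x : tangent p x -> tproj p x = x.
Proof. by rewrite /tangent /tproj => ->; rewrite scale0r subr0. Qed.

Lemma is_derive_lor (V : normedModType R) (Y Z : V -> E) (p v : V) :
  derivable Y p v -> derivable Z p v ->
  is_derive p v (fun q => lor (Y q) (Z q))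
    (lor ('D_v Y p) (Z p) + lor (Y p) ('D_v Z p)).
Proof.
move=> dY dZ.
have cY j : is_derive p v (fun q => Y q 0 j) (('D_v Y p) 0 j).
  rewrite (derive_mx dY) mxE; apply: derivableP.
  by have /derivable_mxP := dY; exact.
have cZ j : is_derive p v (fun q => Z q 0 j) (('D_v Z p) 0 j).
  rewrite (derive_mx dZ) mxE; apply: derivableP.
  by have /derivable_mxP := dZ; exact.
have -> : (fun q => lor (Y q) (Z q)) =
  - ((fun q => Y q 0 0) * (fun q => Z q 0 0)) + \sum_(i < 4)
    ((fun q => Y q 0 (lift ord0 i)) * (fun q => Z q 0 (lift ord0 i))).
  by apply/funext => q; rewrite /lor !fctE fct_sumE.
apply: is_derive_eq.
rewrite /lor !big_ord_recr !big_ord0 /= /GRing.scale /=.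
ring.
Qed.

Lemma nabla_metric X Y Z p : tangent p (Y p) -> tangent p (Z p) ->
  differentiable Y p -> differentiable Z p ->
  'D_(X p) (fun q => lor (Y q) (Z q)) p =
  lor (nabla X Y p) (Z p) + lor (Y p) (nabla X Z p).
Proof.
move=> tY tZ dY dZ; rewrite /nabla lor_tproj// (lorC (Y p)) lor_tproj//.
rewrite (lorC _ (Y p)).
have dYX := diff_derivable (v := X p) dY; have dZX := diff_derivable (v := X p) dZ.
by have [_ ->] := is_derive_lor dYX dZX.
Qed.

(* A curve in the quadric through p with velocity v. *)
Let ray (p v : E) (t : R) : E :=
  (1 + t ^+ 2 * (lor v v / 4))^-1 *:
    ((1 - t ^+ 2 * (lor v v / 4)) *: p + t *: v).

Let ray_deSitter p v t : deSitter p -> tangent p v ->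
  1 + t ^+ 2 * (lor v v / 4) != 0 -> deSitter (ray p v t).
Proof.
rewrite /deSitter /tangent /= => pS vp d0.
rewrite /ray lorZl lorZr !lorDl ![lor _ (_ + _)]lorC !lorDl !lorZl !lorZr.
rewrite pS vp (lorC p v) vp.
have d0' : 4 + t ^+ 2 * lor v v != 0.
  apply: contra d0 => /eqP d0; apply/eqP.
  have -> : 1 + t ^+ 2 * (lor v v / 4) = (4 + t ^+ 2 * lor v v) / 4 by field.
  by rewrite d0 mul0r.
by field.
Qed.

Let is_derive_denom (k : R) :
  is_derive (0 : R) 1 (fun t : R => 1 + k * t ^+ 2 : R) 0.
Proof.
have -> : (fun t : R => 1 + k * t ^+ 2) = cst 1 + k \*: (@id R) ^+ 2.
  by apply/funext => t.
apply: is_derive_eq; by rewrite /= expr1 mulr0 scale0r scaler0 addr0.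
Qed.

Let is_derive_ray p v : is_derive (0 : R) 1 (ray p v) v.
Proof.
set c := lor v v / 4.
have dc j : is_derive (0 : R) 1 (fun t => ray p v t 0 j) (v 0 j).
  have -> : (fun t => ray p v t 0 j) =
    (fun t : R => (1 + c * t ^+ 2)^-1 : R) *
    (p 0 j \*: (fun t : R => 1 + (- c) * t ^+ 2) + v 0 j \*: @id R).
    apply/funext => t; rewrite /ray !mxE !fctE /= -/c /GRing.scale /=.
    by rewrite (mulrC (t ^+ 2)); congr (_ * _); ring.
  have f0 : (fun t : R => 1 + c * t ^+ 2) 0 != 0.
    by rewrite expr0n /= mulr0 addr0 oner_neq0.
  have [df f'0] := is_derive_denom c.
  have dVf : is_derive (0 : R) 1 (fun t : R => (1 + c * t ^+ 2)^-1 : R) 0.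
    apply: DeriveDef; first exact: derivableV.
    by rewrite deriveV// f'0 scaler0.
  have dNc := is_derive_denom (- c).
  apply: is_derive_eq.
  rewrite !scaler0 add0r addr0 expr0n /= mulr0 addr0 invr1 scale1r.
  by rewrite /GRing.scale /= mulr1.
have dr : derivable (ray p v) 0 1.
  by apply/derivable_mxP => i j; rewrite (ord1 i); case: (dc j).
apply: DeriveDef => //; rewrite (derive_mx dr); apply/rowP => j.
by rewrite mxE; case: (dc j).
Qed.

Lemma derive_tangent_field Y p v : (forall q, deSitter q -> tangent q (Y q)) ->
  deSitter p -> tangent p v -> differentiable Y p ->
  lor ('D_v Y p) p = - lor (Y p) v.
Proof.
move=> tY pS vp dY.
have ray0 : ray p v 0 = p.
  by rewrite /ray expr0n /= mul0r addr0 subr0 invr1 !scale1r scale0r addr0.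
have dr := is_derive_ray p v.
have dr0 : differentiable (ray p v) 0 by apply/derivable1_diffP; case: dr.
have dYr0 : differentiable Y (ray p v 0) by rewrite ray0.
have dYr : derivable (Y \o ray p v) 0 1.
  by apply/derivable1_diffP; exact: differentiable_comp.
have E1 : 'D_1 (Y \o ray p v) 0 = 'D_v Y p.
  rewrite (deriveE _ (differentiable_comp dr0 dYr0)) (diff_comp dr0 dYr0) /=.
  by rewrite -(deriveE _ dr0) derive_val ray0 (deriveE _ dY).
have [drr _] := dr.
have [_ ] := is_derive_lor dYr drr.
rewrite E1 derive_val /= ray0 => H.
apply/eqP; rewrite -addr_eq0 -H; apply/eqP.
rewrite (near_eq_derive (g := cst 0)) ?derive_cst ?oner_neq0//.
near=> t; rewrite /=; apply: tY; apply: ray_deSitter => //.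
rewrite mulrC; near: t.
have [/derivable1_diffP/differentiable_continuous dc _] :=
  is_derive_denom (lor v v / 4).
apply: (cvgr_neq0 _ dc).
by rewrite expr0n /= mulr0 addr0 oner_neq0.
Unshelve. all: by end_near. Qed.

Lemma tangent_lie X Y p : (forall q, deSitter q -> tangent q (X q)) ->
  (forall q, deSitter q -> tangent q (Y q)) -> deSitter p ->
  differentiable X p -> differentiable Y p -> tangent p (lie X Y p).
Proof.
move=> tX tY pS dX dY; rewrite /tangent /lie lorBl.
rewrite !derive_tangent_field//; last 2 first.
- exact: tY.
- exact: tX.
by rewrite (lorC (X p)) subrr.
Qed.

Lemma nabla_torsion_free X Y p : (forall q, deSitter q -> tangent q (X q)) ->
  (forall q, deSitter q -> tangent q (Y q)) -> deSitter p ->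
  differentiable X p -> differentiable Y p ->
  nabla X Y p - nabla Y X p = lie X Y p.
Proof.
move=> tX tY pS dX dY.
by rewrite /nabla -tprojB tproj_tangent//; exact: tangent_lie.
Qed.

End DeSitterSpace.

Section Curves.
Variable R : realType.
Notation E := 'rV[R]_5.
Implicit Types (I : set R) (g V : R -> E).

(* Smoothness on a possibly non-open interval: the total function V is a smooth
   extension to an open neighbourhood, so that derivatives at the endpoints of
   I are the one-sided ones. *)
Definition smooth_on I V : Prop := exists U : set R, [/\ open U, I `<=` U &
  forall (n : nat) s, U s -> derivable (derive1n n V) s 1].

Definition velocity g : R -> E := derive1 g.

(* The covariant derivative along g induced by the connection nabla; see
   covD_nabla. *)
Definition covD g V : R -> E := fun s => tproj (g s) (derive1 V s).

Lemma covD_nabla g X (Y : E -> E) s : derivable g s 1 ->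
  differentiable Y (g s) -> X (g s) = velocity g s ->
  covD g (Y \o g) s = nabla X Y (g s).
Proof.
move=> /derivable1_diffP dg dY XE; rewrite /covD /nabla XE /velocity.
rewrite !derive1E (deriveE _ (differentiable_comp dg dY)) (diff_comp dg dY).
by rewrite (deriveE _ dY) (deriveE _ dg).
Qed.

Definition curve_in_deSitter I g : Prop :=
  smooth_on I g /\ forall s, I s -> deSitter (g s).

Definition spacelike_arclength I g : Prop :=
  forall s, I s -> lor (velocity g s) (velocity g s) = 1.

Definition geodesic I g : Prop := forall s, I s -> covD g (velocity g) s = 0.

Definition biharmonic I g : Prop := forall s, I s ->
  let T := velocity g in
  covD g (covD g (covD g T)) s
    - curvature_at (g s) (T s) (covD g T s) (T s) = 0.

Definition frenet_frame I g (N B1 B2 : R -> E) (k1 k2 k3 : R -> R) : Prop :=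
  let T := velocity g in
  [/\ [/\ smooth_on I N, smooth_on I B1 & smooth_on I B2],
      forall s, I s -> [/\ tangent (g s) (T s), tangent (g s) (N s),
        tangent (g s) (B1 s) & tangent (g s) (B2 s)],
      forall s, I s -> [/\ lor (T s) (T s) = 1, lor (N s) (N s) = 1,
        lor (B1 s) (B1 s) = 1 & lor (B2 s) (B2 s) = -1],
      forall s, I s ->
        [/\ lor (T s) (N s) = 0, lor (T s) (B1 s) = 0 & lor (T s) (B2 s) = 0] /\
        [/\ lor (N s) (B1 s) = 0, lor (N s) (B2 s) = 0
          & lor (B1 s) (B2 s) = 0] &
      forall s, I s ->
        [/\ covD g T s = k1 s *: N s,
            covD g N s = - k1 s *: T s + k2 s *: B1 s,
            covD g B1 s = - k2 s *: N s + k3 s *: B2 s &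
            covD g B2 s = k3 s *: B1 s]].

Definition circle_radius_inv_sqrt2 I g : Prop := exists c u v : E,
  [/\ lor u v = 0, lor u u = 2^-1, lor v v = 2^-1 &
      forall s, I s -> g s = c + cos (Num.sqrt 2 * s) *: u
                               + sin (Num.sqrt 2 * s) *: v].

Definition two_frequency_curve (a b : R) : R -> E := fun s =>
  \row_i [:: 0; cos (a * s) / Num.sqrt 2; sin (a * s) / Num.sqrt 2;
             cos (b * s) / Num.sqrt 2; sin (b * s) / Num.sqrt 2]`_i.

End Curves.

(* Main.v *)
(* Let E1, E2, E3 be the first three covariant derivatives of the unit tangent T.
   Constant sectional curvature turns the biharmonic equation into E3 = - E1. As
   <E1, T> = 0 gives <E2, T> = - <E1, E1>, differentiating the latter and using
   <E3, T> = 0 gives <E2, E1> = - <E1, E1>' = - 2 <E2, E1>, so f := <E1, E1> is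
   constant, as is k1, with k1 ^+ 2 = f. One more derivative gives <E2, E2> = f,
   which in Frenet terms says k1 ^+ 2 + k2 ^+ 2 = 1. In the ambient space
   T' = E1 - g, E1' = E2 and E2' = f g - E1, a linear system with constant
   coefficients. If f = 1 then E2 = - T, g + E1 is constant and g - E1 rotates
   with frequency sqrt 2. If f < 1 then g is half the sum of g + E1 / k1 and
   g - E1 / k1, which rotate with frequencies sqrt (1 - k1) and sqrt (1 + k1) in
   orthogonal spacelike planes; B2 at one point completes the basis that defines
   the isometry. *)
Require Import Defs.
From HB Require Import structures.
From mathcomp Require Import all_boot all_order all_algebra.
From mathcomp Require Import all_classical all_reals all_analysis.
From mathcomp Require Import ring lra.
Set Implicit Arguments.
Unset Strict Implicit.
Unset Printing Implicit Defensive.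
Import Order.TTheory GRing.Theory Num.Theory.
Import numFieldNormedType.Exports.
Local Open Scope classical_set_scope.
Local Open Scope ring_scope.

(** * One-variable calculus on an interval that may contain its endpoints *)

Section Analysis.
Variable R : realType.

(* I need not be open: at an endpoint the derivatives agree as one-sided ones. *)
Lemma derive_eq_on_interval (W : normedModType R) (I : set R) (f h : R -> W)
    s df dh :
  is_interval I -> (exists a b, [/\ I a, I b & a < b]) -> I s ->
  (forall t, I t -> f t = h t) -> is_derive s 1 f df -> is_derive s 1 h dh ->
  df = dh.
Proof.
move=> itvI [a [b [Ia Ib ab]]] Is fh [cf <-] [ch <-].
pose q (k : R -> W) t := t^-1 *: ((k \o shift s) (t *: 1) - k s).
(* It suffices to compare difference quotients along one proper filter finer than the punctured
   neighbourhoods of 0: both converge along it, and limits in a normed space are unique. The filter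
   is taken on the side of [s] where [I] continues: the right if [s < b], the left otherwise, since
   then [a < b <= s]. *)
suff [F [PF F0 Fq]] : exists F : set_system R,
    [/\ ProperFilter F, F `=>` (0 : R)^' & \forall t \near F, q f t = q h t].
  have cF k : derivable k s 1 -> q k @ F --> 'D_1 k s.
    by move=> ck; apply: cvg_trans ck; apply: cvg_app.
  have cfh : q f @ F --> 'D_1 h s.
    by apply: cvg_trans (cF _ ch); apply: near_eq_cvg;
      apply: filterS Fq => t ->.
  exact: (cvg_unique (@norm_hausdorff R W) (cF _ cf) cfh).
have qE t : I (t + s) -> q f t = q h t.
  move=> It; rewrite /q /= scaler1 !fh//.
have [sb|bs] := ltP s b.
  exists (0^'+); split.
  - exact: at_right_proper_filter.
  - by apply: within_subset => // x; rewrite /= lt_neqAle eq_sym => /andP[].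
  - near=> t; apply: qE; apply: (itvI s b) => //.
    rewrite lerDr ltW//= -lerBrDr ltW//; near: t.
    by apply: nbhs_right_lt; rewrite subr_gt0.
have as_ : a < s by exact: lt_le_trans bs.
exists (0^'-); split.
- exact: at_left_proper_filter.
- by apply: within_subset => // x; rewrite /= lt_neqAle => /andP[].
- near=> t; apply: qE; apply: (itvI a s) => //.
  rewrite gerDr -lerBlDr; apply/andP; split; rewrite ltW//; near: t.
  by apply: nbhs_left_gt; rewrite subr_lt0.
Unshelve. all: by end_near. Qed.

Lemma derive0_cst_on_interval (I : set R) (f : R -> R) :
  is_interval I -> (forall s, I s -> is_derive s 1 f 0) ->
  forall s t, I s -> I t -> f s = f t.
Proof.
move=> itvI df.
suff cst s t : I s -> I t -> s < t -> f s = f t.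
  by move=> s t Is It; case: (ltgtP s t) => [/cst->//|/cst->//|->].
move=> Is It st.
have Ist x : x \in `[s, t] -> I x by rewrite in_itv; exact: itvI.
have [||c _] := @MVT R f (cst 0) s t st.
- by move=> x /subset_itv_oo_cc xst; apply/df/Ist.
- apply: derivable_within_continuous => y yst.
  by case: (df _ (Ist _ yst)).
- by rewrite mul0r => /eqP; rewrite subr_eq0 => /eqP ->.
Qed.

End Analysis.

(** * Leibniz rules for row-valued maps and the curvature of the sphere *)

Section RowCalculus.
Variable R : realType.
Notation E := 'rV[R]_5.

Lemma is_derive_rowP (V : normedModType R) n (Y : V -> 'rV[R]_n) p v dY :
  is_derive p v Y dY <-> forall j, is_derive p v (fun q => Y q 0 j) (dY 0 j).
Proof.
split=> [[cY <-] j|cY].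
  rewrite (derive_mx cY) mxE; apply: derivableP.
  by have /derivable_mxP := cY; exact.
have dY' : derivable Y p v.
  by apply/derivable_mxP => i j; rewrite (ord1 i); case: (cY j).
apply: DeriveDef => //; rewrite (derive_mx dY'); apply/rowP => j.
by rewrite mxE; case: (cY j).
Qed.

Lemma is_derive_scale (V : normedModType R) n (f : V -> R) (Y : V -> 'rV[R]_n)
    p v df dY :
  is_derive p v f df -> is_derive p v Y dY ->
  is_derive p v (fun q => f q *: Y q) (df *: Y p + f p *: dY).
Proof.
move=> cf /is_derive_rowP cY; apply/is_derive_rowP => j.
have -> : (fun q => (f q *: Y q) 0 j) = f * (fun q => Y q 0 j).
  by apply/funext => q; rewrite !mxE.
have cYj := cY j; apply: is_derive_eq.
by rewrite !mxE addrC /GRing.scale /= (mulrC df).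
Qed.

Lemma is_derive_lorD (V : normedModType R) (Y Z : V -> E) p v dY dZ :
  is_derive p v Y dY -> is_derive p v Z dZ ->
  is_derive p v (fun q => lor (Y q) (Z q)) (lor dY (Z p) + lor (Y p) dZ).
Proof. by move=> [cY <-] [cZ <-]; exact: is_derive_lor. Qed.

Lemma is_derive_tproj (V : normedModType R) (G Y : V -> E) p v dG dY :
  is_derive p v G dG -> is_derive p v Y dY ->
  is_derive p v (fun q => tproj (G q) (Y q))
    (dY - ((lor dY (G p) + lor (Y p) dG) *: G p + lor (Y p) (G p) *: dG)).
Proof.
move=> cG cY; apply: is_deriveB.
by apply: is_derive_scale => //; exact: is_derive_lorD.
Qed.

Lemma lor0l (z : E) : lor 0 z = 0.
Proof. by rewrite -(scale0r (0 : E)) lorZl mul0r. Qed.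

Lemma lorDr (x y z : E) : lor x (y + z) = lor x y + lor x z.
Proof. by rewrite !(lorC x) lorDl. Qed.

Lemma lorNl (x z : E) : lor (- x) z = - lor x z.
Proof. by rewrite -scaleN1r lorZl mulN1r. Qed.

Lemma lorNr (x z : E) : lor x (- z) = - lor x z.
Proof. by rewrite lorC lorNl lorC. Qed.

(** This is constant curvature 1. The derivative of [fun q => tproj q w] along [v] is explicit, and
    its term [lor w q *: v] vanishes at [p] for tangent [w]; differentiating once more leaves only
    [- (lor w u *: v)] for the second covariant derivative. Antisymmetrizing in [x] and [y] gives
    the formula. *)
Lemma curvature_atE (p x y z : E) :
  deSitter p -> tangent p x -> tangent p y -> tangent p z ->
  curvature_at p x y z = lor y z *: x - lor x z *: y.
Proof.
rewrite /deSitter /= => pS.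
have did (q v : E) : is_derive q v id v by exact: is_derive_id.
have dcst (w q v : E) : is_derive q v (fun=> w) 0 by exact: is_derive_cst.
have dproj (w q v : E) : is_derive q v (fun q => tproj q w)
    (- (lor w v *: q + lor w q *: v)).
  apply: is_derive_eq; first exact: is_derive_tproj (did q v) (dcst w q v).
  by rewrite lor0l sub0r add0r.
have nablaE (w q v : E) : nabla (fun q => tproj q v) (fun q => tproj q w) q =
    tproj q (- (lor w (tproj q v) *: q + lor w q *: tproj q v)).
  by rewrite /nabla; case: (dproj w q (tproj q v)) => _ ->.
have nabla2E (u v w : E) : tangent p u -> tangent p v -> tangent p w ->
    nabla (fun q => tproj q u)
      (nabla (fun q => tproj q v) (fun q => tproj q w)) p = - (lor w u *: v).
  move=> pu pv pw.
  have -> : nabla (fun q => tproj q v) (fun q => tproj q w) = fun q =>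
      tproj q (- (lor w (tproj q v) *: q + lor w q *: tproj q v)).
    by apply/funext => q; exact: nablaE.
  have dw := is_derive_lorD (dcst w p u) (dproj v p u).
  have dw' := is_derive_lorD (dcst w p u) (did p u).
  have dW := is_deriveN (is_deriveD (is_derive_scale dw (did p u))
    (is_derive_scale dw' (dproj v p u))).
  have [_ dtW] := is_derive_tproj (did p u) dW.
  rewrite /nabla (tproj_tangent pu); apply: eq_trans (congr1 (tproj p) dtW) _.
  move: pu pv pw; rewrite /tangent /tproj => pu pv pw.
  rewrite !(fctE, lorDl, lorDr, lorBl, lorBr, lorNl, lorNr, lorZl, lorZr) /=.
  rewrite !(lorC p) !(pu, pv, pw, pS, lor0l).
  by apply/rowP => j; rewrite !mxE; ring.
move=> px py pz; rewrite /curvature_at /curvature !nabla2E//.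
(* [nabla] depends on its first field only through the value at the point, so it is enough that the
   bracket vanishes at [p], which follows from the symmetry of [lor x y]. *)
have lie0 : lie (fun q => tproj q x) (fun q => tproj q y) p = 0.
  rewrite /lie; case: (dproj y p (tproj p x)) (dproj x p (tproj p y)).
  move=> _ -> [_ ->]; rewrite !tproj_tangent// px py.
  by apply/rowP => j; rewrite !mxE (lorC y); ring.
rewrite /nabla lie0 derive0 /tproj lor0l scale0r !subr0 opprK addrC.
by rewrite (lorC z) (lorC z).
Qed.

End RowCalculus.

(** * First-order harmonic systems on an interval *)

Section Rotation.
Variable R : realType.

Lemma derive0_cst_on_interval_row n (I : set R) (F : R -> 'rV[R]_n) :
  is_interval I -> (forall s, I s -> is_derive s 1 F 0) ->
  forall s t, I s -> I t -> F s = F t.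
Proof.
move=> itvI dF s t Is It; apply/rowP => j.
apply: (@derive0_cst_on_interval _ I (fun s => F s 0 j)) => // r Ir.
by have /is_derive_rowP/(_ j) := dF r Ir; rewrite mxE.
Qed.

Lemma is_derive_cosM (w s : R) :
  is_derive s 1 (fun t => cos (w * t)) (- (w * sin (w * s))).
Proof.
have dw : is_derive s 1 (w \*: @id R) w.
  by apply: is_derive_eq; rewrite /GRing.scale /= mulr1.
apply: is_derive_eq (is_derive1_comp (is_derive_cos (w * s)) dw) _.
by rewrite mulNr mulrC.
Qed.

Lemma is_derive_sinM (w s : R) :
  is_derive s 1 (fun t => sin (w * t)) (w * cos (w * s)).
Proof.
have dw : is_derive s 1 (w \*: @id R) w.
  by apply: is_derive_eq; rewrite /GRing.scale /= mulr1.
apply: is_derive_eq (is_derive1_comp (is_derive_sin (w * s)) dw) _.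
by rewrite mulrC.
Qed.

(* Rotating the pair (P, Q) back by the angle w s makes it constant. *)
Lemma harmonic_pair n (I : set R) (w : R) (P Q : R -> 'rV[R]_n) s0 :
  is_interval I -> I s0 ->
  (forall s, I s -> is_derive s 1 P (w *: Q s)) ->
  (forall s, I s -> is_derive s 1 Q (- (w *: P s))) ->
  let u := cos (w * s0) *: P s0 - sin (w * s0) *: Q s0 in
  let v := sin (w * s0) *: P s0 + cos (w * s0) *: Q s0 in
  forall s, I s -> P s = cos (w * s) *: u + sin (w * s) *: v.
Proof.
move=> itvI Is0 dP dQ u v s Is.
pose U t := cos (w * t) *: P t - sin (w * t) *: Q t.
pose V t := sin (w * t) *: P t + cos (w * t) *: Q t.
have Us : U s = u.
  apply: (derive0_cst_on_interval_row itvI) => // t It.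
  apply: is_derive_eq (is_deriveB
    (is_derive_scale (is_derive_cosM w t) (dP t It))
    (is_derive_scale (is_derive_sinM w t) (dQ t It))) _.
  by apply/rowP => j; rewrite !mxE; ring.
have Vs : V s = v.
  apply: (derive0_cst_on_interval_row itvI) => // t It.
  apply: is_derive_eq (is_deriveD
    (is_derive_scale (is_derive_sinM w t) (dP t It))
    (is_derive_scale (is_derive_cosM w t) (dQ t It))) _.
  by apply/rowP => j; rewrite !mxE; ring.
rewrite -Us -Vs /U /V; apply/rowP => j; rewrite !mxE.
have /eqP := cos2Dsin2 (w * s); rewrite -subr_eq0 => /eqP cs.
apply/eqP; rewrite -subr_eq0; apply/eqP.
by transitivity (- P s 0 j * (cos (w * s) ^+ 2 + sin (w * s) ^+ 2 - 1));
  [ring | rewrite cs mulr0].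
Qed.

End Rotation.

(** * Orthonormal bases and plane rotations for the Lorentz product *)

Section LorentzProduct.
Variable R : realType.
Notation E := 'rV[R]_5.

Lemma lor_suml n (F : 'I_n -> E) x : lor (\sum_i F i) x = \sum_i lor (F i) x.
Proof.
by elim/big_ind2: _ => [|y a z b <- <-|//]; rewrite ?lor0l ?lorDl.
Qed.

Lemma lor_sumr n (F : 'I_n -> E) x : lor x (\sum_i F i) = \sum_i lor x (F i).
Proof. by rewrite lorC lor_suml; apply: eq_bigr => i _; rewrite lorC. Qed.

(** The rows are the images of the standard basis, so having the same Gram matrix as that basis is
    enough; index 0 carries the negative sign. *)
Lemma lorentz_isometry_rows (e : 'I_5 -> E) :
  lor (e 0) (e 0) = -1 ->
  (forall i, lor (e (lift ord0 i)) (e (lift ord0 i)) = 1) ->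
  (forall i j : 'I_5, (i < j)%N -> lor (e i) (e j) = 0) ->
  lorentz_isometry (\matrix_i e i).
Proof.
move=> e00 eii eij x y; rewrite !mulmx_sum_row lor_suml.
have orth i j : i != j -> lor (e i) (e j) = 0.
  by rewrite neq_ltn => /orP[/eij//|/eij]; rewrite lorC.
have -> : \sum_i lor (x 0 i *: row i (\matrix_i e i))
    (\sum_j y 0 j *: row j (\matrix_i e i)) =
    \sum_i x 0 i * (y 0 i * lor (e i) (e i)).
  apply: eq_bigr => i _; rewrite rowK lor_sumr (bigD1 i)//= rowK lorZl lorZr.
  rewrite big1 ?addr0// => j ji.
  by rewrite rowK lorZl lorZr orth 1?eq_sym// !mulr0.
rewrite big_ord_recl /= e00 mulrN1 mulrN; congr (_ + _).
by apply: eq_bigr => i _; rewrite eii mulr1.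
Qed.

(** The amplitudes [u], [v] of [harmonic_pair] arise from the initial values by such a rotation, so
    they inherit orthogonality and the common squared norm. *)
Lemma lor_rotation (c d r : R) (P Q : E) : c ^+ 2 + d ^+ 2 = 1 ->
  lor P P = r -> lor Q Q = r -> lor P Q = 0 ->
  let u := c *: P - d *: Q in let v := d *: P + c *: Q in
  [/\ lor u v = 0, lor u u = r & lor v v = r].
Proof.
move=> cd PP QQ PQ u v.
rewrite /u /v !(lorDl, lorDr, lorNl, lorNr, lorZl, lorZr) (lorC Q) PP PQ QQ.
have e : (c ^+ 2 + d ^+ 2) * r = r by rewrite cd mul1r.
by split; [ring | rewrite -[RHS]e; ring | rewrite -[RHS]e; ring].
Qed.

End LorentzProduct.

(** * Gauss formula along the curve *)

Section CovariantDerivatives.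
Variables (R : realType) (I : set R) (g : R -> 'rV[R]_5).
Notation E := 'rV[R]_5.
Hypothesis itvI : is_interval I.
Hypothesis ndI : exists s t, [/\ I s, I t & s < t].
Hypothesis gI : curve_in_deSitter I g.

Let T := velocity g.
Let E1 := covD g T.
Let E2 := covD g E1.

Lemma is_derive_velocity s : I s -> is_derive s 1 g (T s).
Proof.
case: gI => -[U [oU IU dU]] _ /IU /(dU 0%N) cg.
by apply: DeriveDef => //; rewrite /T /velocity derive1E.
Qed.

(** Derivability at a point of [I] involves values outside [I] when that point is an endpoint, so
    the computation takes place on the open set [U] where [g] is smooth. *)
Lemma derivable_covDs s : I s ->
  [/\ derivable T s 1, derivable E1 s 1 & derivable E2 s 1].
Proof.
case: gI => -[U [oU IU dU]] _ /IU.
have dn n r : U r -> is_derive r 1 (derive1n n g) (derive1n n.+1 g r).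
  by move=> Ur; apply: DeriveDef (dU n r Ur) _; rewrite /derive1n /= derive1E.
pose dg n := derive1n n g.
(* [A] is the Leibniz expansion of the derivative of [E1], the projection of [dg 2]. Near [s], [E2]
   is therefore the projection of [A], a polynomial in the iterated derivatives of [g]. *)
pose A r := dg 3 r - ((lor (dg 3 r) (g r) + lor (dg 2 r) (dg 1 r)) *: g r
  + lor (dg 2 r) (g r) *: dg 1 r).
have dE1 r : U r -> is_derive r 1 E1 (A r).
  by move=> Ur; exact: is_derive_tproj (dn 0%N r Ur) (dn 2 r Ur).
move=> Us; split; [exact: (dU 1%N) | by case: (dE1 s Us) |].
have dA : is_derive s 1 A _ := is_deriveB (dn 3 s Us)
  (is_deriveD (is_derive_scale (is_deriveD
    (is_derive_lorD (dn 3 s Us) (dn 0%N s Us))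
    (is_derive_lorD (dn 2 s Us) (dn 1%N s Us))) (dn 0%N s Us))
  (is_derive_scale (is_derive_lorD (dn 2 s Us) (dn 0%N s Us)) (dn 1%N s Us))).
have [+ _] := is_derive_tproj (dn 0%N s Us) dA.
apply: near_eq_derivable.
near=> r; rewrite /E2 /covD; congr tproj.
have Ur : U r by near: r; exact: open_nbhs_nbhs.
by rewrite derive1E; case: (dE1 r Ur) => _ ->.
Unshelve. all: by end_near. Qed.

(** Differentiating [lor (V t) (g t) = 0] identifies the normal component of the derivative of [V]
    as [- lor (V s) (T s)]. *)
Lemma is_derive_covD V s : I s -> (forall t, I t -> lor (V t) (g t) = 0) ->
  derivable V s 1 ->
  is_derive s 1 V (covD g V s - lor (V s) (T s) *: g s).
Proof.
move=> Is Vg /derivableP dV; apply: is_derive_eq.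
have := derive_eq_on_interval itvI ndI Is Vg
  (is_derive_lorD dV (is_derive_velocity Is)) (is_derive_cst _ _ _).
move=> /eqP; rewrite addr_eq0 => /eqP H.
by rewrite /covD derive1E /tproj H scaleNr opprK addrK.
Qed.

End CovariantDerivatives.

(** * Integration of the biharmonic system *)

Section Kinematics.
Variables (R : realType) (I : set R).
Notation E := 'rV[R]_5.
(* T, E1 and E2 stand for the velocity and its first two covariant derivatives.
   The hypotheses dT, dE1, dE2 and dN are Gauss formulas; the tangential part
   - E1 in dE2 is the biharmonic equation. *)
Variables (g T E1 E2 N B1 : R -> E) (k1 k2 : R -> R).
Hypothesis itvI : is_interval I.
Hypothesis ndI : exists s t, [/\ I s, I t & s < t].
Hypothesis gg : forall s, I s -> lor (g s) (g s) = 1.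
Hypothesis TT : forall s, I s -> lor (T s) (T s) = 1.
Hypothesis Tg : forall s, I s -> lor (T s) (g s) = 0.
Hypothesis E1g : forall s, I s -> lor (E1 s) (g s) = 0.
Hypothesis E2g : forall s, I s -> lor (E2 s) (g s) = 0.
Hypothesis dg : forall s, I s -> is_derive s 1 g (T s).
Hypothesis dT : forall s, I s ->
  is_derive s 1 T (E1 s - lor (T s) (T s) *: g s).
Hypothesis dE1 : forall s, I s ->
  is_derive s 1 E1 (E2 s - lor (E1 s) (T s) *: g s).
Hypothesis dE2 : forall s, I s ->
  is_derive s 1 E2 (- E1 s - lor (E2 s) (T s) *: g s).

Lemma is_derive_T s : I s -> is_derive s 1 T (E1 s - g s).
Proof. by move=> Is; have := dT Is; rewrite TT// scale1r. Qed.

Lemma lor_E1_T s : I s -> lor (E1 s) (T s) = 0.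
Proof.
move=> Is; have dTs := is_derive_T Is.
have := derive_eq_on_interval itvI ndI Is TT (is_derive_lorD dTs dTs)
  (is_derive_cst _ _ _).
by rewrite lorBl lorBr !(lorC (T s)) (lorC (g s)) Tg// => H; lra.
Qed.

Lemma is_derive_E1 s : I s -> is_derive s 1 E1 (E2 s).
Proof. by move=> Is; have := dE1 Is; rewrite lor_E1_T// scale0r subr0. Qed.

Lemma lor_E2_T s : I s -> lor (E2 s) (T s) = - lor (E1 s) (E1 s).
Proof.
move=> Is; have := derive_eq_on_interval itvI ndI Is lor_E1_T
  (is_derive_lorD (is_derive_E1 Is) (is_derive_T Is)) (is_derive_cst _ _ _).
by rewrite lorBr E1g// => H; lra.
Qed.

Lemma is_derive_E2 s : I s ->
  is_derive s 1 E2 (lor (E1 s) (E1 s) *: g s - E1 s).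
Proof.
by move=> Is; have := dE2 Is; rewrite lor_E2_T// scaleNr opprK addrC.
Qed.

Lemma lor_E2_E1 s : I s -> lor (E2 s) (E1 s) = 0.
Proof.
move=> Is; have dE1s := is_derive_E1 Is.
have := derive_eq_on_interval itvI ndI Is lor_E2_T
  (is_derive_lorD (is_derive_E2 Is) (is_derive_T Is))
  (is_deriveN (is_derive_lorD dE1s dE1s)).
rewrite lorBl lorZl lorBr (lorC (g s)) Tg// lor_E1_T// E2g//.
by rewrite (lorC (E1 s) (E2 s)) => H; lra.
Qed.

Lemma lor_E2_E2 s : I s -> lor (E2 s) (E2 s) = lor (E1 s) (E1 s).
Proof.
move=> Is; have := derive_eq_on_interval itvI ndI Is lor_E2_E1
  (is_derive_lorD (is_derive_E2 Is) (is_derive_E1 Is)) (is_derive_cst _ _ _).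
by rewrite lorBl lorZl (lorC (g s)) E1g// => H; lra.
Qed.

Lemma lor_E1_cst s t : I s -> I t -> lor (E1 s) (E1 s) = lor (E1 t) (E1 t).
Proof.
apply: (derive0_cst_on_interval (f := fun s => lor (E1 s) (E1 s))) => // r Ir.
have dE1r := is_derive_E1 Ir.
apply: is_derive_eq (is_derive_lorD dE1r dE1r) _.
by rewrite (lorC (E1 r)) lor_E2_E1// addr0.
Qed.

Hypothesis E1N : forall s, I s -> E1 s = k1 s *: N s.
Hypothesis dN : forall s, I s ->
  is_derive s 1 N (- k1 s *: T s + k2 s *: B1 s).
Hypothesis NN : forall s, I s -> lor (N s) (N s) = 1.
Hypothesis B1B1 : forall s, I s -> lor (B1 s) (B1 s) = 1.
Hypothesis TB1 : forall s, I s -> lor (T s) (B1 s) = 0.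
Hypothesis E1_neq0 : exists2 s, I s & E1 s <> 0.

Lemma k1_sq s : I s -> k1 s ^+ 2 = lor (E1 s) (E1 s).
Proof. by move=> Is; rewrite E1N// lorZl lorZr NN// mulr1. Qed.

(** A nongeodesic curve has nonzero [E1] at some point only; the constancy of [lor (E1 s) (E1 s)]
    spreads this to all of [I]. *)
Lemma k1_neq0 s : I s -> k1 s != 0.
Proof.
move=> Is; apply/eqP => k0; have [t It] := E1_neq0.
rewrite E1N//; apply.
suff /eqP : k1 t ^+ 2 = 0 by rewrite sqrf_eq0 => /eqP ->; rewrite scale0r.
by rewrite k1_sq// (lor_E1_cst It Is) -k1_sq// k0 expr0n.
Qed.

(** A constant square leaves the sign of [k1] open, and no regularity of [k1] is assumed. Writing
    [k1] as [lor (E1 r) (N r)] makes it differentiable; both terms of the product rule vanish, as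
    [N] is orthogonal to its own derivative and to [E2]. *)
Lemma k1_cst s t : I s -> I t -> k1 s = k1 t.
Proof.
move=> Is It.
have k1E r : I r -> lor (E1 r) (N r) = k1 r.
  by move=> Ir; rewrite E1N// lorZl NN// mulr1.
rewrite -!k1E//; apply: (derive0_cst_on_interval
  (f := fun r => lor (E1 r) (N r)) itvI) => // r Ir.
have := derive_eq_on_interval itvI ndI Ir NN (is_derive_lorD (dN Ir) (dN Ir))
  (is_derive_cst _ _ _).
move: (dN Ir); set N' := _ + _ => dNr; rewrite (lorC (N r)) => N'N.
apply: is_derive_eq (is_derive_lorD (is_derive_E1 Ir) dNr) _.
have := lor_E2_E1 Ir; rewrite (E1N Ir) lorZl lorZr (lorC (N r)).
move=> /eqP; rewrite mulf_eq0 (negbTE (k1_neq0 Ir)) /= => /eqP ->.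
by rewrite (_ : lor N' (N r) = 0); [rewrite add0r mulr0 | lra].
Qed.

Lemma E2_frenet s : I s ->
  E2 s = - k1 s ^+ 2 *: T s + (k1 s * k2 s) *: B1 s.
Proof.
move=> Is.
have E1c t : I t -> E1 t = k1 s *: N t.
  by move=> It; rewrite E1N// (k1_cst It Is).
rewrite (derive_eq_on_interval itvI ndI Is E1c (is_derive_E1 Is)
  (is_deriveZ (k1 s) (dN Is))).
by apply/rowP => j; rewrite !mxE; ring.
Qed.

(** In the frame, [lor_E2_E2] reads k1^2 (k1^2 + k2^2) = k1^2, and the nonzero factor cancels. *)
Lemma k12_sqD s : I s -> k1 s ^+ 2 + k2 s ^+ 2 = 1.
Proof.
move=> Is; have := lor_E2_E2 Is; rewrite -k1_sq// E2_frenet//.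
rewrite !(lorDl, lorDr, lorZl, lorZr) (lorC (B1 s)) TT// TB1// B1B1// => H.
apply: (mulfI (x := k1 s ^+ 2)); first by rewrite sqrf_eq0 k1_neq0.
by rewrite mulr1 -[RHS]H; ring.
Qed.

Lemma circle_case s0 : I s0 -> k1 s0 ^+ 2 = 1 -> circle_radius_inv_sqrt2 I g.
Proof.
move=> Is0 k1s0.
have k1s s : I s -> k1 s ^+ 2 = 1 by move=> Is; rewrite (k1_cst Is Is0).
have E1E1 s : I s -> lor (E1 s) (E1 s) = 1 by move=> Is; rewrite -k1_sq// k1s.
have E2E s : I s -> E2 s = - T s.
  move=> Is; have := k12_sqD Is; rewrite k1s// => k2s.
  have /eqP : k2 s ^+ 2 = 0 by lra.
  rewrite sqrf_eq0 => /eqP k20.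
  by rewrite E2_frenet// k1s// k20 mulr0 scale0r addr0 scaleN1r.
pose w : R := Num.sqrt 2.
have w2 : w ^+ 2 = 2 by rewrite sqr_sqrtr.
have w0 : w != 0 by rewrite sqrtr_eq0 -ltNge.
(* The centre is [c] and the radius vector is [P]. With E2 = - T the derivative of [c] vanishes and
   that of [P] is [T]; the factor [w^-1] in [Q] balances the two equations of the rotation. *)
pose c s := 2^-1 *: (g s + E1 s); pose P s := 2^-1 *: (g s - E1 s).
pose Q s := w^-1 *: T s.
have dP s : I s -> is_derive s 1 P (w *: Q s).
  move=> Is; apply: is_derive_eq (is_deriveZ _
    (is_deriveB (dg Is) (is_derive_E1 Is))) _.
  rewrite E2E//; apply/rowP => j; rewrite !mxE.
  by field.
have dQ s : I s -> is_derive s 1 Q (- (w *: P s)).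
  move=> Is; apply: is_derive_eq (is_deriveZ _ (is_derive_T Is)) _.
  apply/rowP => j; rewrite !mxE.
  rewrite (_ : w^-1 = w / 2); first by field.
  by rewrite -w2; field.
have cc s : I s -> c s = c s0.
  move=> Is; apply: (derive0_cst_on_interval_row itvI) => // t It.
  apply: is_derive_eq (is_deriveZ _
    (is_deriveD (dg It) (is_derive_E1 It))) _.
  by rewrite E2E// subrr scaler0.
have := harmonic_pair itvI Is0 dP dQ; rewrite /=.
set u := _ *: P s0 - _; set v := _ *: P s0 + _ => gE.
have gg0 := gg Is0; have TT0 := TT Is0; have EE := E1E1 _ Is0.
have gT := Tg Is0; have ET := lor_E1_T Is0.
have Eg := E1g Is0.
have PP : lor (P s0) (P s0) = 2^-1.
  rewrite /P !(lorZl, lorZr, lorBl, lorBr) (lorC (g s0)) gg0 EE Eg.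
  by field.
have QQ : lor (Q s0) (Q s0) = 2^-1.
  by rewrite /Q lorZl lorZr TT0 mulr1 -invfM -expr2 w2.
have PQ : lor (P s0) (Q s0) = 0.
  by rewrite /P /Q !(lorZl, lorZr, lorBl) (lorC (g s0)) gT ET subrr !mulr0.
have [uv uu vv] := lor_rotation (cos2Dsin2 (w * s0)) PP QQ PQ.
exists (c s0), u, v; split=> //.
move=> s Is; rewrite -(cc s Is) -addrA -gE//; apply/rowP => j.
by rewrite !mxE; field.
Qed.

(** If e^2 = f, then g + E1 / e is an eigenvector of the second derivative: (g + E1 / e)'' = (e - 1)
    (g + E1 / e). It thus oscillates with frequency a, where a^2 = 1 - e, and [mode_vel] is its
    velocity divided by a. *)
Let mode_pos (e : R) s := 2^-1 *: (g s + e^-1 *: E1 s).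
Let mode_vel (e a : R) s := (2 * a)^-1 *: (T s + e^-1 *: E2 s).

(* e = k1 gives the frequency sqrt (1 - k1), and e = - k1 gives sqrt (1 + k1). *)
Lemma is_derive_mode (e a : R) s : I s -> e != 0 -> a != 0 ->
  a ^+ 2 = 1 - e -> e ^+ 2 = lor (E1 s) (E1 s) ->
  is_derive s 1 (mode_pos e) (a *: mode_vel e a s) /\
  is_derive s 1 (mode_vel e a) (- (a *: mode_pos e s)).
Proof.
move=> Is e0 a0 a2 e2; split.
  apply: is_derive_eq (is_deriveZ _ (is_deriveD (dg Is)
    (is_deriveZ _ (is_derive_E1 Is)))) _.
  by apply/rowP => j; rewrite !mxE; field; rewrite e0 a0.
apply: is_derive_eq (is_deriveZ _ (is_deriveD (is_derive_T Is)
  (is_deriveZ _ (is_derive_E2 Is)))) _.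
rewrite -e2; apply/rowP => j; rewrite !mxE.
have -> : e = 1 - a ^+ 2 by lra.
by field; rewrite a0 -(_ : e = 1 - a ^+ 2) ?e0//; lra.
Qed.

(** Taking e' = e yields squared norms 1/2, and e' = - e yields orthogonality of the two modes. *)
Lemma lor_mode (e a e' a' : R) s : I s -> e != 0 -> e' != 0 -> a != 0 ->
  a' != 0 -> e ^+ 2 = lor (E1 s) (E1 s) -> e' ^+ 2 = e ^+ 2 ->
  [/\ lor (mode_pos e s) (mode_pos e' s) = (1 + e / e') / 4,
      lor (mode_vel e a s) (mode_vel e' a' s)
        = (1 - e - e ^+ 2 / e' + e / e') / (4 * a * a') &
      lor (mode_pos e s) (mode_vel e' a' s) = 0].
Proof.
move=> Is e0 e'0 a0 a'0 e2 ee'.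
rewrite /mode_pos /mode_vel !(lorDl, lorDr, lorZl, lorZr).
rewrite (lorC (g s)) E1g// (lorC (T s)) lor_E2_T// lor_E2_E2// TT// gg//.
rewrite (lorC (g s)) Tg// lor_E1_T// (lorC (g s)) E2g//.
rewrite (lorC (E1 s) (E2 s)) lor_E2_E1// -e2; split.
- by field; rewrite e0 e'0.
- by field; rewrite e0 e'0 a0 a'0.
- by rewrite !(mulr0, addr0).
Qed.

Lemma two_frequency_case s0 (n : E) : I s0 -> k1 s0 ^+ 2 != 1 ->
  lor n n = -1 -> lor n (g s0) = 0 -> lor n (T s0) = 0 ->
  lor n (N s0) = 0 -> lor n (B1 s0) = 0 ->
  let k := k1 s0 in
  [/\ 0 <= 1 - k, 0 <= 1 + k & exists2 L : 'M[R]_5, lorentz_isometry L &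
    forall s, I s ->
      g s = two_frequency_curve (Num.sqrt (1 - k)) (Num.sqrt (1 + k)) s *m L].
Proof.
move=> Is0 k2n1 nn ng nT nN nB k.
have kk : k ^+ 2 < 1.
  by rewrite lt_neqAle k2n1 -(k12_sqD Is0) lerDl sqr_ge0.
have /andP[kl ku] : -1 < k < 1 by apply/andP; split; nra.
pose a := Num.sqrt (1 - k); pose b := Num.sqrt (1 + k); rewrite -/a -/b.
have a2 : a ^+ 2 = 1 - k by rewrite sqr_sqrtr//; lra.
have b2 : b ^+ 2 = 1 - - k by rewrite opprK sqr_sqrtr//; lra.
have a0 : a != 0 by rewrite sqrtr_eq0 -ltNge; lra.
have b0 : b != 0 by rewrite sqrtr_eq0 -ltNge; lra.
have k0 : k != 0 := k1_neq0 Is0.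
have nk0 : - k != 0 by rewrite oppr_eq0.
have kE s : I s -> k ^+ 2 = lor (E1 s) (E1 s).
  by move=> Is; rewrite -k1_sq// /k (k1_cst Is0 Is).
have nkE s : I s -> (- k) ^+ 2 = lor (E1 s) (E1 s).
  by move=> Is; rewrite sqrrN (kE _ Is).
have kk' : (- k) ^+ 2 = k ^+ 2 by rewrite sqrrN.
have da s Is := @is_derive_mode k a s Is k0 a0 a2 (kE s Is).
have db s Is := @is_derive_mode (- k) b s Is nk0 b0 b2 (nkE s Is).
have := harmonic_pair itvI Is0 (fun s Is => (da s Is).1)
  (fun s Is => (da s Is).2).
have := harmonic_pair itvI Is0 (fun s Is => (db s Is).1)
  (fun s Is => (db s Is).2).
have [PPa QQa PQa] := lor_mode Is0 k0 k0 a0 a0 (kE _ Is0) erefl.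
have [PPb QQb PQb] := lor_mode Is0 nk0 nk0 b0 b0 (nkE _ Is0) erefl.
have [PPab QQab PQab] := lor_mode Is0 k0 nk0 a0 b0 (kE _ Is0) kk'.
have [_ _ PQba] := lor_mode Is0 nk0 k0 b0 a0 (nkE _ Is0) (esym kk').
(* At [s0] both [E1] and [E2] are combinations of [T], [N] and [B1], so [n] is orthogonal to every
   mode. *)
have nE1 : lor n (E1 s0) = 0 by rewrite E1N// lorZr nN mulr0.
have nE2 : lor n (E2 s0) = 0.
  by rewrite E2_frenet// lorDr !lorZr nT nB !mulr0 addr0.
have nP e : lor n (mode_pos e s0) = 0.
  by rewrite !(lorZr, lorDr) ng nE1 !(mulr0, addr0).
have nQ e c : lor n (mode_vel e c s0) = 0.
  by rewrite !(lorZr, lorDr) nT nE2 !(mulr0, addr0).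
have half x : x != 0 -> (1 + x / x) / 4 = 2^-1 :> R by move=> x0; field.
rewrite half// in PPa; rewrite half// in PPb.
rewrite invrN mulrN divff// subrr mul0r in PPab.
have {}QQa : lor (mode_vel k a s0) (mode_vel k a s0) = 2^-1.
  by rewrite QQa -mulrA -expr2 a2; field; rewrite k0 subr_eq0 gt_eqF.
have {}QQb : lor (mode_vel (- k) b s0) (mode_vel (- k) b s0) = 2^-1.
  by rewrite QQb -mulrA -expr2 b2; field; rewrite k0 opprK; lra.
have {}QQab : lor (mode_vel k a s0) (mode_vel (- k) b s0) = 0.
  by rewrite QQab; field; rewrite k0 a0 b0.
move: PPa QQa PQa PPb QQb PQb PPab QQab PQab PQba.
move: (nP k) (nP (- k)) (nQ k a) (nQ (- k) b).
have gE s : g s = mode_pos k s + mode_pos (- k) s.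
  by apply/rowP => j; rewrite !mxE; field; rewrite k0.
move: (mode_pos k s0) (mode_pos (- k) s0) (mode_vel k a s0)
  (mode_vel (- k) b s0) => P1 P2 Q1 Q2.
move=> nP1 nP2 nQ1 nQ2 PPa QQa PQa PPb QQb PQb PPab QQab PQab PQba /=.
have [uva uua vva] := lor_rotation (cos2Dsin2 (a * s0)) PPa QQa PQa.
have [uvb uub vvb] := lor_rotation (cos2Dsin2 (b * s0)) PPb QQb PQb.
have cross c d c' d' : lor (c *: P1 + d *: Q1) (c' *: P2 + d' *: Q2) = 0.
  rewrite !(lorDl, lorDr, lorZl, lorZr) PPab QQab PQab (lorC Q1) PQba.
  by rewrite !(mulr0, addr0).
have nc c d : lor n (c *: P1 + d *: Q1) = 0.
  by rewrite !(lorDr, lorZr) nP1 nQ1 !mulr0 addr0.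
have nc' c d : lor n (c *: P2 + d *: Q2) = 0.
  by rewrite !(lorDr, lorZr) nP2 nQ2 !mulr0 addr0.
(* Moving the sign into the coefficient gives all four amplitudes the shape required by [cross],
   [nc] and [nc']. *)
move: uva uua vva uvb uub vvb; rewrite -!scaleNr.
set u1 := _ + (- _) *: Q1; set v1 := _ + _ *: Q1.
set u2 := _ + (- _) *: Q2; set v2 := _ + _ *: Q2.
move=> uva uua vva uvb uub vvb Hb Ha.
pose r : R := Num.sqrt 2.
have r2 : r ^+ 2 = 2 by rewrite sqr_sqrtr.
have r0 : r != 0 by rewrite sqrtr_eq0 -ltNge.
split; [lra | lra |].
(* The timelike [n] takes the slot of the zero coordinate. The amplitudes have squared norm 1/2, so
   the factor sqrt 2 normalizes them and cancels the denominators of [two_frequency_curve]. *)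
pose e (i : 'I_5) := nth n [:: n; r *: u1; r *: v1; r *: u2; r *: v2] i.
exists (\matrix_i e i).
  apply: lorentz_isometry_rows => //.
  - move=> i; have norm w : lor w w = 2^-1 -> lor (r *: w) (r *: w) = 1.
      by rewrite lorZl lorZr mulrA -expr2 r2 => ->; rewrite divff.
    by case: i => -[|[|[|[|//]]]] ? /=; rewrite /e /=; exact: norm.
  - have orth w w' : lor w w' = 0 -> lor (r *: w) (r *: w') = 0.
      by rewrite lorZl lorZr => ->; rewrite !mulr0.
    have orthn w : lor n w = 0 -> lor n (r *: w) = 0.
      by rewrite lorZr => ->; rewrite mulr0.
    case=> -[|[|[|[|[|//]]]]] ? [] [|[|[|[|[|//]]]]] ? //= _; rewrite /e /=;
      by [apply: orthn; rewrite ?nc ?nc' | apply: orth; rewrite ?cross].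
move=> s Is; rewrite gE Ha// Hb// mulmx_sum_row.
rewrite !big_ord_recl big_ord0 !rowK /e /=; apply/rowP => j; rewrite !mxE /=.
by rewrite -/r; field.
Qed.

End Kinematics.

(** * From the Frenet and biharmonic equations to the two cases *)

Theorem theorem3p7 (R : realType) (I : set R) (g N B1 B2 : R -> 'rV[R]_5)
    (k1 k2 k3 : R -> R)
    (I_itv : is_interval I)
    (I_nondegenerate : exists s t, [/\ I s, I t & s < t])
    (g_curve : curve_in_deSitter I g)
    (g_arclength : spacelike_arclength I g)
    (g_nongeodesic : ~ geodesic I g)
    (g_biharmonic : biharmonic I g)
    (g_frenet : frenet_frame I g N B1 B2 k1 k2 k3) :
  circle_radius_inv_sqrt2 I g \/
  exists2 k : R, (forall s, I s -> k1 s = k) &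
    [/\ 0 <= 1 - k, 0 <= 1 + k &
    exists2 L : 'M[R]_5, lorentz_isometry L &
      forall s, I s ->
        g s = two_frequency_curve (Num.sqrt (1 - k)) (Num.sqrt (1 + k)) s *m L].
Proof.
have gT s : I s -> is_derive s 1 g (velocity g s).
  exact: is_derive_velocity.
have gg s : I s -> lor (g s) (g s) = 1 by case: g_curve => _; exact.
have [smN frT frN frO frE] := g_frenet.
have Tg s : I s -> lor (velocity g s) (g s) = 0 by move=> /frT[].
have covDg V s : I s -> lor (covD g V s) (g s) = 0.
  by move=> Is; apply: tangent_tproj; exact: gg.
pose E1 := covD g (velocity g); pose E2 := covD g E1.
have dT s : I s -> is_derive s 1 (velocity g)
    (E1 s - lor (velocity g s) (velocity g s) *: g s).
  move=> Is; have [dTs _ _] := derivable_covDs g_curve Is.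
  exact: (is_derive_covD I_itv I_nondegenerate g_curve Is Tg dTs).
have dE1 s : I s -> is_derive s 1 E1 (E2 s - lor (E1 s) (velocity g s) *: g s).
  move=> Is; have [_ dE1s _] := derivable_covDs g_curve Is.
  exact: (is_derive_covD I_itv I_nondegenerate g_curve Is (covDg _) dE1s).
have dE2' s : I s ->
    is_derive s 1 E2 (covD g E2 s - lor (E2 s) (velocity g s) *: g s).
  move=> Is; have [_ _ dE2s] := derivable_covDs g_curve Is.
  exact: (is_derive_covD I_itv I_nondegenerate g_curve Is (covDg _) dE2s).
have dN' s : I s ->
    is_derive s 1 N (- k1 s *: velocity g s + k2 s *: B1 s).
  move=> Is; have [_ <- _ _] := frE s Is.
  have Ng t : I t -> lor (N t) (g t) = 0 by move=> /frT[].
  have dNs : derivable N s 1.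
    by case: smN => -[U [_ IU dU]] _ _; exact: (dU 0%N s (IU s Is)).
  (* As [N] is orthogonal to the velocity, its ambient derivative has no normal part. *)
  have := is_derive_covD I_itv I_nondegenerate g_curve Is Ng dNs.
  have [[TN _ _] _] := frO s Is.
  by rewrite (lorC (N s)) TN scale0r subr0.
have NN s : I s -> lor (N s) (N s) = 1 by move=> /frN[].
have BB s : I s -> lor (B1 s) (B1 s) = 1 by move=> /frN[].
have TB s : I s -> lor (velocity g s) (B1 s) = 0 by move=> /frO[[]].
have E1N s : I s -> E1 s = k1 s *: N s by move=> /frE[].
have E1n0 : exists2 s, I s & E1 s <> 0.
  apply: contrapT => E1_0; apply: g_nongeodesic => s Is.
  by apply: contrapT => E1s; apply: E1_0; exists s.
have E1T s : I s -> lor (E1 s) (velocity g s) = 0.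
  move=> Is; rewrite E1N// lorZl lorC.
  by have [[-> _ _] _] := frO s Is; rewrite mulr0.
have dE2 s : I s ->
    is_derive s 1 E2 (- E1 s - lor (E2 s) (velocity g s) *: g s).
  move=> Is; have := dE2' s Is.
  suff -> : covD g E2 s = - E1 s by [].
  (* Constant curvature gives R(T, E1) T = <E1, T> T - <T, T> E1 = - E1. *)
  have := g_biharmonic s Is; rewrite /= -/E1 -/E2.
  rewrite (curvature_atE (gg s Is) (Tg s Is) (covDg _ s Is) (Tg s Is)).
  rewrite E1T// g_arclength// scale0r scale1r sub0r opprK.
  by move=> /eqP; rewrite addr_eq0 => /eqP.
have E1g : forall s, I s -> lor (E1 s) (g s) = 0 := covDg (velocity g).
have E2g : forall s, I s -> lor (E2 s) (g s) = 0 := covDg E1.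
have [s0 [_ [Is0 _ _]]] := I_nondegenerate.
have [k1s0|k1s0] := eqVneq (k1 s0 ^+ 2) 1.
  left; exact: (circle_case I_itv I_nondegenerate gg g_arclength Tg E1g E2g gT
    dT dE1 dE2 E1N dN' NN BB TB E1n0 Is0 k1s0).
right; exists (k1 s0).
  move=> s Is; exact: (k1_cst I_itv I_nondegenerate g_arclength Tg E1g E2g
    dT dE1 dE2 E1N dN' NN E1n0 Is Is0).
(* The timelike vector [B2 s0] serves as [n]. *)
have [[_ _ TB2] [_ NB2 BB2]] := frO s0 Is0.
have [_ _ _ nn] := frN s0 Is0; have [_ _ _ ng] := frT s0 Is0.
rewrite lorC in TB2; rewrite lorC in NB2; rewrite lorC in BB2.
exact: (two_frequency_case I_itv I_nondegenerate gg g_arclength Tg E1g E2g gT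
  dT dE1 dE2 E1N dN' NN BB TB E1n0 Is0 k1s0 nn ng TB2 NB2 BB2).
Qed.
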